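(* Let $M,N$ be positive integers, let $Z_0\ge Z_1\ge\dots\ge Z_{N-1}$ be real numbers, let $(S^{(t)})_{t\in\mathbb Z}$ be real numbers, and let $W^{(m)}_r\in\mathbb R$ ($r=0,\dots,N-1$, $m\in\mathbb Z$) with $W^{(m)}_r=W^{(m\bmod M)}_r$, such that \[ W^{(m)}_{r_1}-W^{(m+1)}_{r_1}+W^{(m+1)}_{r_0}-W^{(m)}_{r_0}+\frac{Z_{r_0}-Z_{r_1}}{M}\ge0 \] for all $m=0,\dots,M-1$ and all $0\le r_0<r_1\le N-1$. For $k,t\in\mathbb Z$ let $T^{(k,t)}_0:=0$ and, for $n=1,\dots,N$, \[ T^{(k,t)}_n:=\min_{0\le r_0<r_1<\dots<r_{n-1}\le N-1}\sum_{j=0}^{n-1}\Big(W^{(k+j)}_{r_j}+\frac{k+(M+1)j}{M}Z_{r_j}+\sum_{\tau=0}^{t-1}\min(Z_{r_j},S^{(\tau)})\Big), \] and $T^{(k,t)}_n:=+\infty$ for $n>N$. Define \begin{gather*} Q^{(k,t)}_n=T^{(k,t)}_n-T^{(k,t)}_{n+1}+T^{(k+1,t)}_{n+1}-T^{(k+1,t)}_n,\quad D^{(k,t)}_n=T^{(k,t+1)}_n-T^{(k,t)}_{n+1}+T^{(k+1,t)}_{n+1}-T^{(k+1,t+1)}_n\quad(0\le n\le N-1),\\ E^{(k,t)}_n=T^{(k,t)}_{n+2}-T^{(k,t)}_{n+1}+T^{(k+M,t)}_n-T^{(k+M,t)}_{n+1},\quad \tilde E^{(k,t)}_n=T^{(k,t)}_{n+2}-T^{(k,t)}_{n+1}+T^{(k,t+1)}_n-T^{(k,t+1)}_{n+1},\\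 F^{(k,t)}_n=T^{(k,t)}_{n+2}-T^{(k,t+1)}_{n+1}+T^{(k+M,t+1)}_n-T^{(k+M,t)}_{n+1}+S^{(t)}\quad(0\le n\le N-1). \end{gather*} Then these give a solution of the nonautonomous ultradiscrete hungry Toda lattice with the finite lattice condition: for all $k,t\in\mathbb Z$, $E^{(k,t)}_{N-1}=\tilde E^{(k,t)}_{N-1}=+\infty$ and \begin{gather*} Q^{(k,t+1)}_n=\min(D^{(k,t)}_n,\tilde E^{(k,t)}_n)\ (0\le n\le N-1),\qquad E^{(k,t+1)}_n=\min(F^{(k,t)}_n,\tilde E^{(k+M,t)}_n)\ (0\le n\le N-2),\\ D^{(k,t)}_{n+1}=D^{(k,t)}_n-Q^{(k,t+1)}_n+Q^{(k,t)}_{n+1},\qquad \tilde E^{(k+1,t)}_n=\tilde E^{(k,t)}_n-Q^{(k,t+1)}_n+Q^{(k,t)}_{n+1}\qquad(0\le n\le N-2),\\ F^{(k,t)}_{n+1}=F^{(k,t)}_n-E^{(k,t+1)}_n+E^{(k,t)}_{n+1},\qquad \tilde E^{(k,t)}_{n+1}=\tilde E^{(k+M,t)}_n-E^{(k,t+1)}_n+E^{(k,t)}_{n+1}\qquad(0\le n\le N-2), \end{gather*} with boundary conditions \[ D^{(k,t)}_0=Q^{(k,t)}_0,\quad F^{(k,t)}_0=E^{(k,t)}_0+\max\Big(0,S^{(t)}-\sum_{j=0}^{M-1}Q^{(k+j,t)}_0\Big),\quad \tilde E^{(k,t)}_0=E^{(k,t)}_0+\max\Big(0,\sum_{j=0}^{M-1}Q^{(k+j,t)}_0-S^{(t)}\Big).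 \]
   Context: Arithmetic with $+\infty$: $a+\infty=+\infty$ for $a\in\mathbb R\cup\{+\infty\}$, $\min(a,+\infty)=a$; expressions containing $+\infty$ with a minus sign occur only as $(+\infty)-a$ with $a$ finite, which equals $+\infty$. Sums $\sum_{\tau=0}^{t-1}a_\tau$ equal $0$ for $t=0$ and $-\sum_{\tau=t}^{-1}a_\tau$ for $t<0$. *)

(* Defs.v *)
From HB Require Import structures.
From mathcomp Require Import all_boot all_order all_algebra.
From mathcomp Require Import reals constructive_ereal.
Set Implicit Arguments. Unset Strict Implicit. Unset Printing Implicit Defensive.
Import Order.TTheory GRing.Theory Num.Theory.
Local Open Scope ring_scope.

(* sum_{tau=0}^{t-1} a tau for t : int, with the convention
   sum = 0 for t = 0 and = - sum_{tau=t}^{-1} a tau for t < 0. *)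
Definition sumZ (R : numDomainType) (a : int -> R) (t : int) : R :=
  match t with
  | Posz n => \sum_(i < n) a (Posz i)
  | Negz n => - \sum_(i < n.+1) a (t + Posz i)
  end.

Definition strict_incr (n N : nat) (r : {ffun 'I_n -> 'I_N}) : bool :=
  [forall i : 'I_n, forall j : 'I_n, (i < j)%N ==> (r i < r j)%N].

Definition Tval (R : realType) (M N : nat) (W : int -> 'I_N -> R)
  (Z : 'I_N -> R) (S : int -> R) (k t : int) (n : nat) : \bar R :=
  if n == 0%N then 0%E
  else if (n <= N)%N then
    \big[Order.min/+oo%E]_(r : {ffun 'I_n -> 'I_N} | strict_incr r)
      ((\sum_(j < n)
          (W (k + Posz j) (r j)
           + ((k + Posz (M.+1 * j)%N)%:~R / M%:R) * Z (r j)
           + sumZ (fun tau => Order.min (Z (r j)) (S tau)) t))%:E)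
  else +oo%E.

Local Open Scope ereal_scope.

Section Quantities.
Variables (R : realType) (M : nat) (T : int -> int -> nat -> \bar R) (S : int -> R).

Definition Qf (k t : int) (n : nat) : \bar R :=
  T k t n - T k t n.+1 + T (k + 1)%R t n.+1 - T (k + 1)%R t n.
Definition Df (k t : int) (n : nat) : \bar R :=
  T k (t + 1)%R n - T k t n.+1 + T (k + 1)%R t n.+1 - T (k + 1)%R (t + 1)%R n.
Definition Ef (k t : int) (n : nat) : \bar R :=
  T k t n.+2 - T k t n.+1 + T (k + M%:Z)%R t n - T (k + M%:Z)%R t n.+1.
Definition Etf (k t : int) (n : nat) : \bar R :=
  T k t n.+2 - T k t n.+1 + T k (t + 1)%R n - T k (t + 1)%R n.+1.
Definition Ff (k t : int) (n : nat) : \bar R :=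
  T k t n.+2 - T k (t + 1)%R n.+1 + T (k + M%:Z)%R (t + 1)%R n
  - T (k + M%:Z)%R t n.+1 + (S t)%:E.
End Quantities.

(* Main.v *)
(** Write [T k t n] as the minimum of [\sum_(j < n) c j (r j)] over increasing
    [r], where [c] is the cost at [(k, t)].  The hypothesis on [W] says that
    replacing [k] by [k + 1] changes [c j r] by a quantity nonincreasing in [r];
    replacing [k] by [k + M] adds [Z r], and replacing [t] by [t + 1] adds
    [u r = min (Z r) S].  After clearing the differences, the two nonlinear
    equations become three-term tropical bilinear identities for [T]:
      T(k+1,t+1)_n+1 + T(k,t)_n+1
        = min (T(k+1,t)_n+1 + T(k,t+1)_n+1, T(k,t)_n+2 + T(k+1,t+1)_n),
      T(k,t+1)_n+1 + T(k+M,t)_n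
        = min (T(k,t)_n+1 + T(k+M,t+1)_n + S, T(k+M,t)_n+1 + T(k,t+1)_n).
    Each inequality follows by turning a pair of increasing sequences into
    another one, exchanging entries pointwise (possibly after a shift of the
    index): since [u] and [Z - u] are nonincreasing in [r], no exchange increases
    the total cost.  The second identity with [n = 0] gives the boundary
    conditions; the linear equations are cancellations. *)
Require Import Defs.
From HB Require Import structures.
From mathcomp Require Import all_boot all_order all_algebra.
From mathcomp Require Import reals constructive_ereal.
From mathcomp Require Import zify ring lra.
Set Implicit Arguments. Unset Strict Implicit. Unset Printing Implicit Defensive.
Import Order.TTheory GRing.Theory Num.Theory.
Local Open Scope ring_scope.

(** * Minima of separable costs over increasing sequences *)

Definition strict_upto (N n : nat) (r : nat -> 'I_N) : Prop :=
  forall i, (i.+1 < n)%N -> (r i < r i.+1)%N.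

(** Sequences are total on [nat], only their first [n] entries mattering, so that index shifts need
    no casts. The alternative [+oo] covers [n > N], where no increasing sequence exists; for [0 < N]
    and [n <= N] the first clause excludes it. *)
Definition is_min_sum (R : realType) (N : nat) (c : nat -> 'I_N -> R)
    (n : nat) (v : \bar R) : Prop :=
  (forall r, strict_upto n r -> (v <= (\sum_(j < n) c j (r j))%:E)%E) /\
  (v = +oo%E \/
   exists2 r, strict_upto n r & v = (\sum_(j < n) c j (r j))%:E).

Lemma strict_upto_lt (N n : nat) (r : nat -> 'I_N) (i j : nat) :
  strict_upto n r -> (i < j < n)%N -> (r i < r j)%N.
Proof.
move=> hr; elim: j => [|j IH]; first by rewrite ltn0.
rewrite ltnS leq_eqVlt andb_orl => /orP[/andP[/eqP -> jn]|/andP[ij jn]].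
  exact: hr.
apply: ltn_trans (hr _ jn); apply: IH; lia.
Qed.

Lemma strict_upto_ge (N n : nat) (r : nat -> 'I_N) (i : nat) :
  strict_upto n r -> (i < n)%N -> (i <= r i)%N.
Proof.
move=> hr; elim: i => // i IH iltn.
by have := hr _ iltn; have := IH (ltnW iltn); lia.
Qed.

Lemma is_min_sum_ext (R : realType) (N : nat) (c c' : nat -> 'I_N -> R) n v :
  (forall j x, c j x = c' j x) -> is_min_sum c n v -> is_min_sum c' n v.
Proof.
move=> e; have E r : \sum_(j < n) c j (r j) = \sum_(j < n) c' j (r j).
  by apply: eq_bigr => j _; rewrite e.
move=> [h1 h2]; split=> [r hr|]; first by rewrite -E; exact: h1.
by case: h2 => [->|[r hr ->]]; [left|right; exists r; rewrite ?E].
Qed.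

(** The sequence [0, 1, ..., n - 1] is admissible, so its real cost bounds [v]. *)
Lemma is_min_sum_fin (R : realType) (N : nat) (c : nat -> 'I_N -> R) n v :
  (0 < N)%N -> (n <= N)%N -> is_min_sum c n v -> exists x, v = x%:E.
Proof.
move=> hN nN [h1 [vy|[r _ ->]]]; last by eexists.
have := h1 (fun j => insubd (Ordinal hN) j); rewrite vy => h.
suff : (+oo <= (\sum_(j < n) c j (insubd (Ordinal hN) j : 'I_N))%:E)%E.
  by rewrite leye_eq.
apply: h => i iltn; rewrite !val_insubd.
by rewrite (leq_trans iltn nN) (ltn_trans (ltnSn i) (leq_trans iltn nN)).
Qed.

(** It suffices to turn minimisers [r], [s] of the right-hand side into competitors for the left; an
    infinite right-hand side is trivial. *)
Lemma is_min_sum_add_le (R : realType) (N : nat) (c1 c2 c3 c4 : nat -> 'I_N -> R)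
    n1 n2 n3 n4 v1 v2 v3 v4 (d : R) :
  is_min_sum c1 n1 v1 -> is_min_sum c2 n2 v2 ->
  is_min_sum c3 n3 v3 -> is_min_sum c4 n4 v4 ->
  (forall r s, strict_upto n3 r -> strict_upto n4 s ->
    exists r' s', [/\ strict_upto n1 r', strict_upto n2 s' &
      \sum_(j < n1) c1 j (r' j) + \sum_(j < n2) c2 j (s' j) <=
      \sum_(j < n3) c3 j (r j) + \sum_(j < n4) c4 j (s j) + d]) ->
  (v1 + v2 <= v3 + v4 + d%:E)%E.
Proof.
move=> [h1 _] [h2 _] [_ [->|[r hr ->]]] [_ e4] H.
  by case: e4 => [->|[s _ ->]]; rewrite leey.
case: e4 => [->|[s hs ->]]; first by rewrite leey.
have [r' [s' [hr' hs' le]]] := H r s hr hs.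
apply: (le_trans (leeD (h1 _ hr') (h2 _ hs'))).
by rewrite -!EFinD lee_fin.
Qed.

(** * Exchange inequalities for pairs of increasing sequences *)

Section Exchange.
Variables (R : realType) (N : nat) (Z : 'I_N -> R) (S : R).
Hypothesis hZ : forall i j : 'I_N, (i <= j)%N -> Z j <= Z i.

Let u x := Num.min (Z x) S.

Let u_nincr (x y : 'I_N) : (x <= y)%N -> u y <= u x.
Proof. by move=> /hZ h; rewrite /u; case: (leP (Z x) S); case: (leP (Z y) S) => *; lra. Qed.

Let Zu_nincr (x y : 'I_N) : (x <= y)%N -> Z y - u y <= Z x - u x.
Proof. by move=> /hZ h; rewrite /u; case: (leP (Z x) S); case: (leP (Z y) S) => *; lra. Qed.

Let u_leZ x : u x <= Z x. Proof. by rewrite /u ge_min lexx. Qed.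
Let u_leS x : u x <= S. Proof. by rewrite /u ge_min lexx orbT. Qed.

Ltac strict_tac :=
  repeat match goal with |- context [if (?a <= ?b)%N then _ else _] =>
    case: (leqP a b) => ? end; lia.

(* [b] and [b'] stand for the costs at [(k, t)] and [(k + 1, t)]. *)
Section Shift.
Variables b b' : nat -> 'I_N -> R.
Hypothesis bS : forall j x, b j.+1 x = b' j x + Z x.
Hypothesis b_monge : forall j (x y : 'I_N), (x <= y)%N ->
  b' j y - b j y <= b' j x - b j x.

(** Take the pointwise maximum and minimum of [r] and [s]. Where [r j <= s j], [b_monge] pays for
    the exchange; elsewhere only [u] moves, from [s j] to the larger [r j]. *)
Lemma shift_le_same n v1 v2 v3 v4 :
  is_min_sum (fun j x => b' j x + u x) n v1 -> is_min_sum b n v2 ->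
  is_min_sum b' n v3 -> is_min_sum (fun j x => b j x + u x) n v4 ->
  (v1 + v2 <= v3 + v4)%E.
Proof.
move=> h1 h2 h3 h4; rewrite -[leRHS]adde0.
apply: (is_min_sum_add_le (d := 0) h1 h2 h3 h4) => r s hr hs.
exists (fun j => if (r j <= s j)%N then s j else r j).
exists (fun j => if (r j <= s j)%N then r j else s j).
split=> [i /[dup] /hr ? /hs ?|i /[dup] /hr ? /hs ?|].
- by strict_tac.
- by strict_tac.
rewrite addr0 -!big_split; apply: ler_sum => j _ /=.
case: leqP => [/(b_monge j)|/ltnW /u_nincr]; lra.
Qed.

(** Compare [r j.+1] with [s j]: the smaller becomes entry [j] of the first new sequence, the larger
    entry [j.+1] of the second. By [bS] both carry [b' j], so only [Z] and [u] are redistributed.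
    The ends [r 0] and [r n.+1] have no partner; the latter trades [Z] for [u <= Z]. *)
Lemma shift_le_diff n v1 v2 v3 v4 :
  is_min_sum (fun j x => b' j x + u x) n.+1 v1 -> is_min_sum b n.+1 v2 ->
  is_min_sum b n.+2 v3 -> is_min_sum (fun j x => b' j x + u x) n v4 ->
  (v1 + v2 <= v3 + v4)%E.
Proof.
move=> h1 h2 h3 h4; rewrite -[leRHS]adde0.
apply: (is_min_sum_add_le (d := 0) h1 h2 h3 h4) => r s hr hs.
exists (fun j => if (s j <= r j.+1)%N && (j < n)%N then s j else r j.+1).
exists (fun j => if j is i.+1 then if (s i <= r i.+1)%N then r i.+1 else s i
                 else r 0%N).
split=> [i i_n|[|i] i_n|].
- have := hr i.+1; rewrite !ltnS => /(_ i_n).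
  move: i_n; rewrite ltnS => i_n; rewrite i_n andbT.
  case: (ltnP i.+1 n) => [/hs|_]; rewrite ?andbT ?andbF; strict_tac.
- by have := hr 0%N isT; strict_tac.
- have := hr i.+1 (ltnW i_n); have := hs i i_n; strict_tac.
rewrite addr0 [X in X + _ <= _]big_ord_recr [X in _ + X <= _]big_ord_recl.
rewrite [X in _ <= X + _]big_ord_recl [X in _ <= _ + X + _]big_ord_recr /=.
rewrite ltnn andbF bS; under eq_bigr do rewrite ltn_ord andbT.
have := u_leZ (r n.+1).
suff : \sum_(j < n) (b' j (if (s j <= r j.+1)%N then s j else r j.+1) +
                  u (if (s j <= r j.+1)%N then s j else r j.+1)) +
       \sum_(j < n) b (bump 0 j) (if (s j <= r j.+1)%N then r j.+1 else s j) <=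
       \sum_(j < n) b (bump 0 j) (r (bump 0 j)) +
       \sum_(j < n) (b' j (s j) + u (s j)) by lra.
rewrite -!big_split; apply: ler_sum => j _ /=; rewrite /bump /= add1n !bS.
by case: leqP => [_|/ltnW /Zu_nincr]; lra.
Qed.

(* Either [u (s j) <= u (r j)] for all [j], or [s i < r i] with [Z (r i) < S] for
   some [i]; in the latter case [Z - u] vanishes on [r i], [r i.+1], ..., so the
   tail of [r] can be moved one position up at no cost. *)
Lemma shift_ge n v1 v2 v3 v4 v5 v6 :
  is_min_sum (fun j x => b' j x + u x) n.+1 v1 -> is_min_sum b n.+1 v2 ->
  is_min_sum b' n.+1 v3 -> is_min_sum (fun j x => b j x + u x) n.+1 v4 ->
  is_min_sum b n.+2 v5 -> is_min_sum (fun j x => b' j x + u x) n v6 ->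
  (Order.min (v3 + v4) (v5 + v6) <= v1 + v2)%E.
Proof.
move=> [_ [->|[r hr ->]]] [_ e2] [h3 _] [h4 _] [h5 _] [h6 _].
  by case: e2 => [->|[s _ ->]]; rewrite leey.
case: e2 => [->|[s hs ->]]; first by rewrite leey.
rewrite ge_min; case: (boolP [forall j : 'I_n.+1, (r j <= s j)%N || (S <= Z (r j))]).
  move=> /forallP H; apply/orP; left.
  apply: (le_trans (leeD (h3 _ hr) (h4 _ hs))).
  rewrite -!EFinD lee_fin -!big_split; apply: ler_sum => j _ /=.
  case/orP: (H j) => [/u_nincr|H1]; first by lra.
  suff : u (s j) <= u (r j) by lra.
  by rewrite {2}/u min_r.
rewrite negb_forall => /existsP[i]; rewrite negb_or -ltnNge -ltNge => /andP[sr ZS].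
apply/orP; right.
have f0 j : (i <= j < n.+1)%N -> u (r j) = Z (r j).
  move=> ij; rewrite /u min_l //; apply: le_trans (ltW ZS); apply: hZ.
  have [<-//|ne] := eqVneq (nat_of_ord i) j.
  apply: ltnW; apply: strict_upto_lt hr _; lia.
(* Below [i], the larger of [r l] and [s l.+1] goes to [s'] and the smaller to [r']; from [i] on,
   [s'] follows [r] and [r'] follows [s]. At the join, [s i < r i] keeps [s'] increasing. *)
pose s' j := if j is l.+1 then
   if (l < i)%N && (r l <= s l.+1)%N then s l.+1 else r l else s 0%N.
pose r' j := if (j < i)%N && (r j <= s j.+1)%N then r j else s j.+1.
have hs' : strict_upto n.+2 s'.
  have ni := ltn_ord i; move=> [|l] ln; rewrite /s'.
    case: (posnP i) => [i0|i0] /=; first by rewrite i0 in sr *; exact: sr.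
    have := hs 0%N ltac:(lia); strict_tac.
  have := hr l ln; have := hs l ln; have := hs l.+1.
  case: (ltngtP l.+1 i) => /= [li|li|li].
  - move=> /(_ ltac:(lia)); strict_tac.
  - lia.
  - move: sr; rewrite -li; strict_tac.
have hr' : strict_upto n r'.
  move=> l ln; rewrite /r'.
  have := hr l (ltnW ln); have := hs l (ltnW ln); have := hs l.+1 ln.
  case: (ltngtP l.+1 i) => /= [li|li|li].
  - strict_tac.
  - lia.
  - strict_tac.
apply: (le_trans (leeD (h5 _ hs') (h6 _ hr'))).
rewrite -!EFinD lee_fin.
rewrite [X in X + _ <= _]big_ord_recl [X in _ + X + _ <= _]big_ord_recr.
rewrite [X in _ <= X + _]big_ord_recr [X in _ <= _ + X]big_ord_recl /=.
rewrite /bump /= add1n.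
have -> /= : (n < i)%N = false by have := ltn_ord i; lia.
have := f0 n; rewrite -ltnS ltn_ord ltnSn => /(_ isT) fn; rewrite bS fn.
suff : \sum_(j < n) b j.+1 (s' j.+1) + \sum_(j < n) (b' j (r' j) + u (r' j)) <=
       \sum_(j < n) (b' j (r j) + u (r j)) + \sum_(j < n) b j.+1 (s j.+1).
  by lra.
rewrite -!big_split; apply: ler_sum => j _ /=; rewrite !bS /s' /r'.
case: (ltnP j i) => /= [ji|ij].
  by case: leqP => [_|/ltnW /Zu_nincr]; lra.
have := f0 j; rewrite ij (ltn_trans (ltn_ord j)) // => /(_ isT).
by have := u_leZ (s j.+1); lra.
Qed.

End Shift.

(** * Exchanges between the levels [k] and [k + M] *)

Section Jump.
Variables b : nat -> 'I_N -> R.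
(** Since the cost at position [j.+1] is the cost at [(k + 1, t)] in position [j] plus [Z], this is
    again the monotonicity of the passage from [k] to [k + 1]. *)
Hypothesis b_monge : forall j (x y : 'I_N), (x <= y)%N ->
  b j.+1 y - b j y - Z y <= b j.+1 x - b j x - Z x.

(** Sort [s j] against [r j.+1], the larger going to the longer sequence. The unpaired [r 0]
    acquires [u (r 0) <= S], whence the constant. *)
Lemma jump_le_S n v1 v2 v3 v4 :
  is_min_sum (fun j x => b j x + u x) n.+1 v1 ->
  is_min_sum (fun j x => b j x + Z x) n v2 ->
  is_min_sum b n.+1 v3 ->
  is_min_sum (fun j x => b j x + Z x + u x) n v4 ->
  (v1 + v2 <= v3 + v4 + S%:E)%E.
Proof.
move=> h1 h2 h3 h4.
apply: (is_min_sum_add_le h1 h2 h3 h4) => r s hr hs.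
exists (fun j => if j is i.+1 then if (s i <= r i.+1)%N then r i.+1 else s i
                 else r 0%N).
exists (fun j => if (s j <= r j.+1)%N then s j else r j.+1).
split=> [[|i] i_n|i i_n|].
- by have := hr 0%N i_n; strict_tac.
- have := hr i.+1 i_n; have := hs i i_n; strict_tac.
- have := hr i.+1 i_n; have := hs i i_n; strict_tac.
rewrite [X in X + _ <= _]big_ord_recl [X in _ <= X + _ + _]big_ord_recl /=.
have := u_leS (r 0%N).
suff : \sum_(j < n) (b (bump 0 j) (if (s j <= r j.+1)%N then r j.+1 else s j) +
                  u (if (s j <= r j.+1)%N then r j.+1 else s j)) +
       \sum_(j < n) (b j (if (s j <= r j.+1)%N then s j else r j.+1) +
                  Z (if (s j <= r j.+1)%N then s j else r j.+1)) <=
       \sum_(j < n) b (bump 0 j) (r (bump 0 j)) +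
       \sum_(j < n) (b j (s j) + Z (s j) + u (s j)) by lra.
rewrite -!big_split; apply: ler_sum => j _ /=; rewrite /bump /= add1n.
by case: leqP => [/u_nincr|/ltnW /(b_monge j)]; lra.
Qed.

(** Here entries are sorted at equal positions: minima receive [u], maxima [Z]. The unpaired top
    entry [r n] trades [Z] for [u]. *)
Lemma jump_le_Z n v1 v2 v3 v4 :
  is_min_sum (fun j x => b j x + u x) n.+1 v1 ->
  is_min_sum (fun j x => b j x + Z x) n v2 ->
  is_min_sum (fun j x => b j x + Z x) n.+1 v3 ->
  is_min_sum (fun j x => b j x + u x) n v4 ->
  (v1 + v2 <= v3 + v4)%E.
Proof.
move=> h1 h2 h3 h4; rewrite -[leRHS]adde0.
apply: (is_min_sum_add_le (d := 0) h1 h2 h3 h4) => r s hr hs.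
exists (fun j => if (s j <= r j)%N && (j < n)%N then s j else r j).
exists (fun j => if (s j <= r j)%N then r j else s j).
split=> [i i_n|i i_n|].
- have := hr i i_n; move: i_n; rewrite ltnS => i_n; rewrite i_n andbT.
  case: (ltnP i.+1 n) => [/hs|_]; rewrite ?andbT ?andbF; strict_tac.
- have := hr i (ltnW i_n); have := hs i i_n; strict_tac.
rewrite addr0 [X in X + _ <= _]big_ord_recr [X in _ <= X + _]big_ord_recr /=.
rewrite ltnn andbF; under eq_bigr do rewrite ltn_ord andbT.
have := u_leZ (r n).
suff : \sum_(j < n) (b j (if (s j <= r j)%N then s j else r j) +
                  u (if (s j <= r j)%N then s j else r j)) +
       \sum_(j < n) (b j (if (s j <= r j)%N then r j else s j) +
                  Z (if (s j <= r j)%N then r j else s j)) <=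
       \sum_(j < n) (b j (r j) + Z (r j)) +
       \sum_(j < n) (b j (s j) + u (s j)) by lra.
rewrite -!big_split; apply: ler_sum => j _ /=.
by case: leqP => [_|/ltnW /Zu_nincr]; lra.
Qed.

Lemma jump_ge n v1 v2 v3 v4 v5 v6 :
  is_min_sum (fun j x => b j x + u x) n.+1 v1 ->
  is_min_sum (fun j x => b j x + Z x) n v2 ->
  is_min_sum b n.+1 v3 ->
  is_min_sum (fun j x => b j x + Z x + u x) n v4 ->
  is_min_sum (fun j x => b j x + Z x) n.+1 v5 ->
  is_min_sum (fun j x => b j x + u x) n v6 ->
  (Order.min (v3 + v4 + S%:E) (v5 + v6) <= v1 + v2)%E.
Proof.
move=> [_ [->|[r hr ->]]] [_ e2] [h3 _] [h4 _] [h5 _] [h6 _].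
  by case: e2 => [->|[s _ ->]]; rewrite leey.
case: e2 => [->|[s hs ->]]; first by rewrite leey.
(* [ok j] makes [u (r j)] at least [u (s j.-1)], or [S] if [j = 0]; once it fails
   at some [i], [Z - u] vanishes on [r i], [r i.+1], ... *)
pose ok j := (if j is l.+1 then (r j <= s l)%N else false) || (S <= Z (r j)).
rewrite ge_min; case: (boolP [forall j : 'I_n.+1, ok j]).
  move=> /forallP H; apply/orP; left.
  apply: (le_trans (leeD (leeD (h3 _ hr) (h4 _ hs)) (lexx _))).
  rewrite -!EFinD lee_fin.
  rewrite [X in X + _ + _ <= _]big_ord_recl [X in _ <= X + _]big_ord_recl /=.
  have -> : u (r 0%N) = S by rewrite /u min_r //; exact: (H ord0).
  suff : \sum_(j < n) b (bump 0 j) (r (bump 0 j)) +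
         \sum_(j < n) (b j (s j) + Z (s j) + u (s j)) <=
         \sum_(j < n) (b (bump 0 j) (r (bump 0 j)) + u (r (bump 0 j))) +
         \sum_(j < n) (b j (s j) + Z (s j)) by lra.
  rewrite -!big_split; apply: ler_sum => j _ /=.
  have := H (lift ord0 j); rewrite /ok /bump /= add1n.
  case/orP => [/u_nincr|H1]; first by lra.
  suff : u (s j) <= u (r j.+1) by lra.
  by rewrite {2}/u min_r.
rewrite negb_forall => /existsP[i]; rewrite negb_or -ltNge => /andP[sr ZS].
apply/orP; right.
have f0 j : (i <= j < n.+1)%N -> u (r j) = Z (r j).
  move=> ij; rewrite /u min_l //; apply: le_trans (ltW ZS); apply: hZ.
  have [<-//|ne] := eqVneq (nat_of_ord i) j.
  apply: ltnW; apply: strict_upto_lt hr _; lia.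
(* Below [i] the entries are sorted pointwise; from [i] on both sequences stay, but [r] now pays
   [Z], equal to [u] there, and [s] pays [u <= Z]. The failure of [ok i] makes the join of [r']
   increasing. *)
pose r' j := if (j < i)%N && (r j <= s j)%N then s j else r j.
pose s' j := if (j < i)%N && (r j <= s j)%N then r j else s j.
have ni := ltn_ord i.
have hr' : strict_upto n.+1 r'.
  move=> l ln; rewrite /r'; have := hr l ln; have := hs l.
  case: (ltngtP l.+1 i) => /= [li|li|li].
  - move=> /(_ ltac:(lia)); strict_tac.
  - lia.
  - move: sr; rewrite -li -ltnNge; strict_tac.
have hs' : strict_upto n s'.
  move=> l ln; rewrite /s'; have := hr l (ltnW ln); have := hs l ln.
  case: (ltngtP l.+1 i) => /= [li|li|li].
  - strict_tac.
  - lia.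
  - strict_tac.
apply: (le_trans (leeD (h5 _ hr') (h6 _ hs'))).
rewrite -!EFinD lee_fin.
rewrite [X in X + _ <= _]big_ord_recr [X in _ <= X + _]big_ord_recr /=.
have -> : r' n = r n by rewrite /r'; have -> /= : (n < i)%N = false by lia.
have := f0 n; rewrite -ltnS ltn_ord ltnSn => /(_ isT) ->.
suff : \sum_(j < n) (b j (r' j) + Z (r' j)) + \sum_(j < n) (b j (s' j) + u (s' j)) <=
       \sum_(j < n) (b j (r j) + u (r j)) + \sum_(j < n) (b j (s j) + Z (s j)).
  by lra.
rewrite -!big_split; apply: ler_sum => j _ /=; rewrite /s' /r'.
case: (ltnP j i) => /= [ji|ij].
  by case: leqP => [_|/ltnW /Zu_nincr]; lra.
have := f0 j; rewrite ij (ltn_trans (ltn_ord j)) // => /(_ isT).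
by have := u_leZ (s j); lra.
Qed.

End Jump.
End Exchange.

(** * The costs behind [T] and its bilinear identities *)

Lemma sumZS (R : numDomainType) (a : int -> R) (t : int) :
  sumZ a (t + 1) = sumZ a t + a t.
Proof.
case: t => [n|[|n]].
- by rewrite -PoszD addn1 /= big_ord_recr.
- by rewrite /= big_ord0 big_ord1 addr0 addNr.
- have -> : Negz n.+1 + 1 = Negz n by rewrite !NegzE; lia.
  rewrite /= [X in - X + _]big_ord_recl addr0 opprD addrAC addNr add0r.
  by congr (- _).
Qed.

Section Tau.
Variables (R : realType) (M N : nat) (Z : 'I_N -> R) (S : int -> R).
Variable W : int -> 'I_N -> R.
Hypotheses (hM : (0 < M)%N) (hN : (0 < N)%N).
Hypothesis hZ : forall i j : 'I_N, (i <= j)%N -> Z j <= Z i.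
Hypothesis hWper : forall (m : int) (r : 'I_N), W m r = W (m %% M%:Z)%Z r.
Hypothesis hW : forall (m : nat) (r0 r1 : 'I_N), (m < M)%N -> (r0 < r1)%N ->
  0 <= W m%:Z r1 - W (m%:Z + 1) r1 + W (m%:Z + 1) r0 - W m%:Z r0
       + (Z r0 - Z r1) / M%:R.

Let M0 : M%:R != 0 :> R. Proof. by rewrite pnatr_eq0 -lt0n. Qed.

Definition weight (k t : int) (j : nat) (x : 'I_N) : R :=
  W (k + Posz j) x + ((k + Posz (M.+1 * j)%N)%:~R / M%:R) * Z x
  + sumZ (fun tau => Order.min (Z x) (S tau)) t.

Let T := Tval M W Z S.

Lemma Tval_min k t n : is_min_sum (weight k t) n (T k t n).
Proof.
rewrite /T /Tval; case: eqP => [->|n0].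
  split=> [r _|]; first by rewrite big_ord0.
  right; exists (fun=> Ordinal hN); last by rewrite big_ord0.
  by move=> i; rewrite ltn0.
case: leqP => [nN|Nn]; last first.
  split=> [r hr|]; last by left.
  (* The last entry would be at least [n.-1 >= N]. *)
  have := strict_upto_ge (i := n.-1) hr; have := ltn_ord (r n.-1); lia.
split=> [r hr|].
  rewrite (bigD1 [ffun i : 'I_n => r i]) /=.
    rewrite ge_min; apply/orP; left; rewrite lee_fin; apply: ler_sum => j _.
    by rewrite ffunE.
  apply/forallP => i; apply/forallP => j; apply/implyP => ij; rewrite !ffunE.
  by apply: strict_upto_lt hr _; rewrite ij ltn_ord.
set P := fun r : {ffun 'I_n -> 'I_N} => strict_incr r.
set G := fun r : {ffun 'I_n -> 'I_N} => (\sum_(j < n) weight k t j (r j))%:E.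
change (let v := \big[Order.min/+oo%E]_(r | P r) G r in v = +oo%E \/
  exists2 r, strict_upto n r & v = (\sum_(j < n) weight k t j (r j))%:E).
(* The disjunction holds for [+oo] and passes to binary minima, each being one of its arguments. *)
apply: (big_ind (fun v => v = +oo%E \/
  exists2 r, strict_upto n r & v = (\sum_(j < n) weight k t j (r j))%:E)).
- by left.
- by move=> x y hx hy; case: (leP x y).
move=> r Pr; right; exists (fun j => if insub j is Some i then r i else Ordinal hN).
  move=> i i_n; case: insubP => [p _ pE|]; last by rewrite (ltnW i_n).
  case: insubP => [q _ qE|]; last by rewrite i_n.
  by move/forallP: Pr => /(_ p)/forallP/(_ q)/implyP; apply; rewrite pE qE.
by congr EFin; apply: eq_bigr => j _; rewrite valK.
Qed.

Lemma Tval_fin k t n : (n <= N)%N -> exists x, T k t n = x%:E.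
Proof. by move=> nN; apply: is_min_sum_fin hN nN (Tval_min k t n). Qed.

Lemma weight_t k t j x :
  weight k (t + 1) j x = weight k t j x + Num.min (Z x) (S t).
Proof. by rewrite /weight sumZS addrA. Qed.

(** In [(M + 1)(j + 1) = (M + 1) j + 1 + M] the unit is absorbed by [k + 1], and [M / M] leaves one
    [Z x]. *)
Lemma weight_jS k t j x : weight k t j.+1 x = weight (k + 1) t j x + Z x.
Proof.
rewrite /weight; have -> : k + Posz j.+1 = k + 1 + Posz j by lia.
have -> : k + Posz (M.+1 * j.+1)%N = k + 1 + Posz (M.+1 * j)%N + Posz M by lia.
by rewrite [(_ + Posz M)%:~R]intrD -pmulrn; field.
Qed.

Lemma weight_kM k t j x : weight (k + M%:Z) t j x = weight k t j x + Z x.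
Proof.
rewrite /weight; have -> : W (k + M%:Z + Posz j) x = W (k + Posz j) x.
  by rewrite hWper [RHS]hWper addrAC modzDr.
have -> : k + M%:Z + Posz (M.+1 * j)%N = k + Posz (M.+1 * j)%N + Posz M by lia.
by rewrite [(_ + Posz M)%:~R]intrD -pmulrn; field.
Qed.

(** Periodicity extends the hypothesis from [0 <= m < M] to every integer [k]. *)
Lemma W_monge k (x y : 'I_N) : (x <= y)%N ->
  W (k + 1) y - W k y + Z y / M%:R <= W (k + 1) x - W k x + Z x / M%:R.
Proof.
rewrite leq_eqVlt => /orP[/eqP/val_inj -> //|xy].
have kM : (k %% M%:Z)%Z = Posz `|(k %% M%:Z)%Z|%N.
  by rewrite gez0_abs // modz_ge0 //; lia.
have ltM : (`|(k %% M%:Z)%Z| < M)%N.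
  by rewrite -ltz_nat -kM ltz_pmod.
have W1 z : W (k + 1) z = W ((k %% M%:Z)%Z + 1) z.
  by rewrite hWper [RHS]hWper modzDml.
have := hW ltM xy; rewrite -kM -!W1 -!hWper mulrBl; lra.
Qed.

(** In the difference the sums over [tau] cancel and [Z] keeps the coefficient [1 / M], so [W_monge]
    applies at [k + j]. *)
Lemma weight_monge k t j (x y : 'I_N) : (x <= y)%N ->
  weight (k + 1) t j y - weight k t j y <= weight (k + 1) t j x - weight k t j x.
Proof.
move=> xy; have H z : weight (k + 1) t j z - weight k t j z =
    W (k + Posz j + 1) z - W (k + Posz j) z + Z z / M%:R.
  rewrite /weight; have -> : k + 1 + Posz j = k + Posz j + 1 by lia.
  have -> : k + 1 + Posz (M.+1 * j)%N = k + Posz (M.+1 * j)%N + 1 by lia.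
  by rewrite [(_ + 1)%:~R]intrD; ring.
by rewrite !H; exact: W_monge.
Qed.

(** Neighbouring values of [T] are expressed through the single cost at [(k, t)], as the exchange
    inequalities require. *)
Let Tt k t n : is_min_sum (fun j x => weight k t j x + Num.min (Z x) (S t))
  n (T k (t + 1) n).
Proof.
by apply: is_min_sum_ext (Tval_min k (t + 1) n) => j x; rewrite weight_t.
Qed.

Let TM k t n : is_min_sum (fun j x => weight k t j x + Z x)
  n (T (k + M%:Z) t n).
Proof.
by apply: is_min_sum_ext (Tval_min (k + M%:Z) t n) => j x; rewrite weight_kM.
Qed.

Let TMt k t n : is_min_sum
  (fun j x => weight k t j x + Z x + Num.min (Z x) (S t))
  n (T (k + M%:Z) (t + 1) n).
Proof.
by apply: is_min_sum_ext (Tt (k + M%:Z) t n) => j x; rewrite weight_kM.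
Qed.

Lemma Tval_shift k t n :
  (T (k + 1)%R (t + 1)%R n.+1 + T k t n.+1 =
   Order.min (T (k + 1)%R t n.+1 + T k (t + 1)%R n.+1)
             (T k t n.+2 + T (k + 1)%R (t + 1)%R n))%E.
Proof.
have mon := @weight_monge k t; have jS := weight_jS k t.
apply/eqP; rewrite eq_le le_min -andbA; apply/and3P; split.
- exact: (shift_le_same hZ mon
    (Tt _ _ _) (Tval_min _ _ _) (Tval_min _ _ _) (Tt _ _ _)).
- exact: (shift_le_diff hZ jS
    (Tt _ _ _) (Tval_min _ _ _) (Tval_min _ _ _) (Tt _ _ _)).
- exact: (shift_ge hZ jS
    (Tt _ _ _) (Tval_min _ _ _) (Tval_min _ _ _) (Tt _ _ _)
    (Tval_min _ _ _) (Tt _ _ _)).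
Qed.

Lemma Tval_jump k t n :
  (T k (t + 1)%R n.+1 + T (k + M%:Z)%R t n =
   Order.min (T k t n.+1 + T (k + M%:Z)%R (t + 1)%R n + (S t)%:E)
             (T (k + M%:Z)%R t n.+1 + T k (t + 1)%R n))%E.
Proof.
have mon j (x y : 'I_N) : (x <= y)%N ->
    weight k t j.+1 y - weight k t j y - Z y <=
    weight k t j.+1 x - weight k t j x - Z x.
  by move=> /(@weight_monge k t j); rewrite !weight_jS; lra.
apply/eqP; rewrite eq_le le_min -andbA; apply/and3P; split.
- exact: (jump_le_S hZ mon
    (Tt _ _ _) (TM _ _ _) (Tval_min _ _ _) (TMt _ _ _)).
- exact: (jump_le_Z hZ
    (Tt _ _ _) (TM _ _ _) (TM _ _ _) (Tt _ _ _)).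
- exact: (jump_ge hZ
    (Tt _ _ _) (TM _ _ _) (Tval_min _ _ _) (TMt _ _ _)
    (TM _ _ _) (Tt _ _ _)).
Qed.

Lemma Tval_oo k t n : (N < n)%N -> T k t n = +oo%E.
Proof. by case: n => // n; rewrite ltnNge /T /Tval => /negbTE ->. Qed.

End Tau.

(** * The lattice equations and boundary conditions *)

Lemma sum_Qf0 (R : realType) (T : int -> int -> nat -> \bar R) (t : int) (M : nat) :
  (forall k, T k t 0%N = 0%E) -> (forall k, exists x, T k t 1%N = x%:E) ->
  forall k, (\sum_(j < M) Qf T (k + j%:Z)%R t 0%N = T (k + M%:Z)%R t 1%N - T k t 1%N)%E.
Proof.
move=> T0 T1 k.
(* As [T] vanishes at index 0, [Q] is a difference of consecutive values at index 1; [fine] moves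
   the sum to [R], where it telescopes. *)
have QE i : Qf T i t 0%N = (fine (T (i + 1)%R t 1%N) - fine (T i t 1%N))%:E.
  rewrite /Qf !T0; have [x ->] := T1 i; have [y ->] := T1 (i + 1).
  by rewrite -!(EFinN, EFinD) /=; congr EFin; ring.
have -> : (T (k + M%:Z)%R t 1%N - T k t 1%N)%E =
    (fine (T (k + M%:Z)%R t 1%N) - fine (T k t 1%N))%:E.
  by have [x ->] := T1 k; have [y ->] := T1 (k + M%:Z).
under eq_bigr => j _ do rewrite QE -addrA -PoszD addn1.
rewrite sumEFin; congr EFin.
rewrite -(big_mkord xpredT
  (fun j => fine (T (k + j.+1%:Z)%R t 1%N) - fine (T (k + j%:Z)%R t 1%N))).
by rewrite (telescope_sumr (fun j : nat => fine (T (k + j%:Z)%R t 1%N))) // addr0.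
Qed.

Theorem theorem5 (R : realType) (M N : nat) (hM : (0 < M)%N) (hN : (0 < N)%N)
  (Z : 'I_N -> R) (S : int -> R) (W : int -> 'I_N -> R)
  (hZ : forall i j : 'I_N, (i <= j)%N -> Z j <= Z i)
  (hWper : forall (m : int) (r : 'I_N), W m r = W (m %% M%:Z)%Z r)
  (hW : forall (m : nat) (r0 r1 : 'I_N), (m < M)%N -> (r0 < r1)%N ->
     0 <= W m%:Z r1 - W (m%:Z + 1) r1 + W (m%:Z + 1) r0 - W m%:Z r0
          + (Z r0 - Z r1) / M%:R) :
  let T := Tval M W Z S in
  let Q := Qf T in
  let D := Df T in
  let E := Ef M T in
  let Et := Etf T in
  let F := Ff M T S in
  forall k t : int,
    (E k t N.-1 = +oo%E /\ Et k t N.-1 = +oo%E)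
    /\ (forall n : nat, (n < N)%N ->
          Q k (t + 1)%R n = Order.min (D k t n) (Et k t n))
    /\ (forall n : nat, (n.+1 < N)%N ->
          E k (t + 1)%R n = Order.min (F k t n) (Et (k + M%:Z)%R t n))
    /\ (forall n : nat, (n.+1 < N)%N ->
          D k t n.+1 = (D k t n - Q k (t + 1)%R n + Q k t n.+1)%E)
    /\ (forall n : nat, (n.+1 < N)%N ->
          Et (k + 1)%R t n = (Et k t n - Q k (t + 1)%R n + Q k t n.+1)%E)
    /\ (forall n : nat, (n.+1 < N)%N ->
          F k t n.+1 = (F k t n - E k (t + 1)%R n + E k t n.+1)%E)
    /\ (forall n : nat, (n.+1 < N)%N ->
          Et k t n.+1 = (Et (k + M%:Z)%R t n - E k (t + 1)%R n + E k t n.+1)%E)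
    /\ D k t 0%N = Q k t 0%N
    /\ F k t 0%N = (E k t 0%N + Order.max 0%E
                      ((S t)%:E - \sum_(j < M) Q (k + j%:Z)%R t 0%N))%E
    /\ Et k t 0%N = (E k t 0%N + Order.max 0%E
                      (\sum_(j < M) Q (k + j%:Z)%R t 0%N - (S t)%:E))%E.
Proof.
move=> T Q D E Et F k t.
have T0 i t' : T i t' 0%N = 0%E by [].
have Tfin i t' n : (n <= N)%N -> exists x, T i t' n = x%:E.
  exact: (Tval_fin Z S W hM hN).
have Too i t' : T i t' N.+1 = +oo%E by exact: (Tval_oo M Z S W i t' (ltnSn N)).
have shift n := Tval_shift S hM hN hZ hWper hW k t n.
have jump n := Tval_jump S hM hN hZ hWper hW k t n.
rewrite -/T in shift jump.
have sumQ : (\sum_(j < M) Q (k + j%:Z)%R t 0%N = T (k + M%:Z)%R t 1%N - T k t 1%N)%E.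
  by apply: sum_Qf0 => // i; exact: Tfin.
(* [split] also closes [D k t 0 = Q k t 0], both sides having the same normal form. *)
do ?split.
- rewrite /E /Ef prednK //.
  have [x ->] := Tfin k t N (leqnn _).
  have [y ->] := Tfin (k + M%:Z) t N (leqnn _).
  have [z ->] := Tfin (k + M%:Z) t N.-1 (leq_pred _).
  by rewrite Too.
- rewrite /Et /Etf prednK //.
  have [x ->] := Tfin k t N (leqnn _).
  have [y ->] := Tfin k (t + 1) N (leqnn _).
  have [z ->] := Tfin k (t + 1) N.-1 (leq_pred _).
  by rewrite Too.
- move=> n nN; rewrite /Q /D /Et /Qf /Df /Etf.
  have := shift n.
  have [x1 ->] := Tfin k (t + 1) n (ltnW nN).
  have [x2 ->] := Tfin k (t + 1) n.+1 nN.
  have [x3 ->] := Tfin (k + 1) (t + 1) n.+1 nN.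
  have [x4 ->] := Tfin (k + 1) (t + 1) n (ltnW nN).
  have [x5 ->] := Tfin k t n.+1 nN.
  have [x6 ->] := Tfin (k + 1) t n.+1 nN.
  (* For [n.+1 = N] the term [T k t n.+2] is [+oo]: both minima reduce to their first branch. *)
  case: (ltnP n.+1 N) => [n1N|Nn].
    have [x7 ->] := Tfin k t n.+2 n1N.
    rewrite -!(EFinN, EFinD) -!EFin_min => -[h]; congr EFin; move: h.
    case: (leP (x6 + x2)); case: (leP (x1 - x5 + x6 - x4)); lra.
  have -> : n.+2 = N.+1 by lia.
  by rewrite Too /= !(min_idPl (leey _)) => -[h]; congr EFin; lra.
- move=> n nN; rewrite /E /F /Et /Ef /Ff /Etf.
  (* Subtracting [T k (t + 1) n.+1 + T (k + M) t n.+1 + T (k + M) (t + 1) n.+1 - T (k + M) (t + 1)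
     n] turns the branches into [F] and [Et]. *)
  have := jump n.+1.
  have [x1 ->] := Tfin k (t + 1) n.+2 nN.
  have [x2 ->] := Tfin k (t + 1) n.+1 (ltnW nN).
  have [x3 ->] := Tfin (k + M%:Z) (t + 1) n.+1 (ltnW nN).
  have [x4 ->] := Tfin (k + M%:Z) (t + 1) n (ltnW (ltnW nN)).
  have [x5 ->] := Tfin k t n.+2 nN.
  have [x6 ->] := Tfin (k + M%:Z) t n.+1 (ltnW nN).
  have [x7 ->] := Tfin (k + M%:Z) t n.+2 nN.
  rewrite -!(EFinN, EFinD) -!EFin_min => -[h]; congr EFin; move: h.
  case: (leP (x5 + x3 + S t)); case: (leP (x5 - x2 + x4 - x6 + S t)); lra.
- move=> n nN; rewrite /D /Q /Df /Qf.
  have [x1 ->] := Tfin k (t + 1) n.+1 (ltnW nN).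
  have [x2 ->] := Tfin k (t + 1) n (ltnW (ltnW nN)).
  have [x3 ->] := Tfin (k + 1) (t + 1) n.+1 (ltnW nN).
  have [x4 ->] := Tfin (k + 1) (t + 1) n (ltnW (ltnW nN)).
  have [x5 ->] := Tfin k t n.+1 (ltnW nN).
  have [x6 ->] := Tfin k t n.+2 nN.
  have [x7 ->] := Tfin (k + 1) t n.+1 (ltnW nN).
  have [x8 ->] := Tfin (k + 1) t n.+2 nN.
  by rewrite -!(EFinN, EFinD); congr EFin; ring.
- move=> n nN; rewrite /Et /Q /Etf /Qf.
  have [x1 ->] := Tfin k (t + 1) n.+1 (ltnW nN).
  have [x2 ->] := Tfin k (t + 1) n (ltnW (ltnW nN)).
  have [x3 ->] := Tfin (k + 1) (t + 1) n.+1 (ltnW nN).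
  have [x4 ->] := Tfin (k + 1) (t + 1) n (ltnW (ltnW nN)).
  have [x5 ->] := Tfin k t n.+1 (ltnW nN).
  have [x6 ->] := Tfin k t n.+2 nN.
  have [x7 ->] := Tfin (k + 1) t n.+1 (ltnW nN).
  have [x8 ->] := Tfin (k + 1) t n.+2 nN.
  by rewrite -!(EFinN, EFinD); congr EFin; ring.
- move=> n nN; rewrite /F /E /Ff /Ef.
  have [x1 ->] := Tfin k (t + 1) n.+2 nN.
  have [x2 ->] := Tfin k (t + 1) n.+1 (ltnW nN).
  have [x3 ->] := Tfin (k + M%:Z) (t + 1) n.+1 (ltnW nN).
  have [x4 ->] := Tfin (k + M%:Z) (t + 1) n (ltnW (ltnW nN)).
  have [x5 ->] := Tfin k t n.+2 nN.
  have [x6 ->] := Tfin (k + M%:Z) t n.+1 (ltnW nN).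
  have [x7 ->] := Tfin (k + M%:Z) t n.+2 nN.
  (* For [n.+2 = N] both sides are [+oo] through [T k t N.+1]. *)
  case: (ltnP n.+2 N) => [n1N|Nn].
    have [x8 ->] := Tfin k t n.+3 n1N.
    by rewrite -!(EFinN, EFinD); congr EFin; ring.
  have -> : n.+3 = N.+1 by lia.
  by rewrite Too.
- move=> n nN; rewrite /Et /E /Etf /Ef.
  have [x1 ->] := Tfin k (t + 1) n.+2 nN.
  have [x2 ->] := Tfin k (t + 1) n.+1 (ltnW nN).
  have [x3 ->] := Tfin (k + M%:Z) (t + 1) n.+1 (ltnW nN).
  have [x4 ->] := Tfin (k + M%:Z) (t + 1) n (ltnW (ltnW nN)).
  have [x5 ->] := Tfin k t n.+2 nN.
  have [x6 ->] := Tfin (k + M%:Z) t n.+1 (ltnW nN).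
  have [x7 ->] := Tfin (k + M%:Z) t n.+2 nN.
  case: (ltnP n.+2 N) => [n1N|Nn].
    have [x8 ->] := Tfin k t n.+3 n1N.
    by rewrite -!(EFinN, EFinD); congr EFin; ring.
  have -> : n.+3 = N.+1 by lia.
  by rewrite Too.
(* At index 0 the identity reads [T k (t + 1) 1 = min (T k t 1 + S t, T (k + M) t 1)]; [F - E] is
   the excess of the first branch over this minimum, and [Et - E] below that of the second. *)
- rewrite sumQ /F /E /Ff /Ef !T0; have := jump 0%N; rewrite !T0.
  have [x1 ->] := Tfin k (t + 1) 1%N hN.
  have [x2 ->] := Tfin (k + M%:Z) t 1%N hN.
  have [x3 ->] := Tfin k t 1%N hN.
  rewrite -!(EFinN, EFinD) -!EFin_min -!EFin_max => -[h].
  case: (ltnP 1 N) => [n1N|Nn].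
    have [x4 ->] := Tfin k t 2%N n1N.
    rewrite -!(EFinN, EFinD); congr EFin; move: h.
    case: (leP (x3 + 0 + S t)); case: (leP 0 (S t - (x2 - x3))); lra.
  have -> : 2%N = N.+1 by lia.
  by rewrite Too.
- rewrite sumQ /Et /E /Etf /Ef !T0; have := jump 0%N; rewrite !T0.
  have [x1 ->] := Tfin k (t + 1) 1%N hN.
  have [x2 ->] := Tfin (k + M%:Z) t 1%N hN.
  have [x3 ->] := Tfin k t 1%N hN.
  rewrite -!(EFinN, EFinD) -!EFin_min -!EFin_max => -[h].
  case: (ltnP 1 N) => [n1N|Nn].
    have [x4 ->] := Tfin k t 2%N n1N.
    rewrite -!(EFinN, EFinD); congr EFin; move: h.
    case: (leP (x3 + 0 + S t)); case: (leP 0 (x2 - x3 - S t)); lra.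
  have -> : 2%N = N.+1 by lia.
  by rewrite Too.
Qed.
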